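(* Let $M$ be a monoid, and let $Q$ be a nonempty set of nonzero elements of $M$. If $Q$ is linked to $M$, then $$M=\operatorname{Ap}(M,Q)+\langle Q\rangle .$$
   Context: All monoids are additive, commutative, cancellative and reduced (the only unit is $0$). $\mathbb N$ denotes the nonnegative integers. For $a,b\in M$, $a\le_M b$ means $b=a+c$ for some $c\in M$. $\langle Q\rangle$ is the submonoid generated by $Q$; $\operatorname{Ap}(M,Q)=M\setminus(Q+M)$; $X+Y=\{x+y\mid x\in X,y\in Y\}$. A non-empty subset $Q$ of $M$ is linked to $M$ if for each $x\in M\setminus\{0\}$ there exists $c(x)\in\mathbb N$ such that whenever $\sum_{q\in Q}\lambda_q q\le_M x$ with $\lambda_q\in\mathbb N$ (all but finitely many zero), one has $\sum_{q\in Q}\lambda_q\le c(x)$. *)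

(* Defs.v *)
From mathcomp Require Import all_boot all_algebra.
From mathcomp Require Import boolp classical_sets functions cardinality fsbigop.

Set Implicit Arguments.
Unset Strict Implicit.
Unset Printing Implicit Defensive.

Import GRing.Theory.

Local Open Scope classical_set_scope.
Local Open Scope ring_scope.

(* An nmodType is a commutative additive monoid; the decidable equality and
   choice operator it carries exist classically on every type. *)

Definition cancellative (M : nmodType) : Prop :=
  right_injective (@GRing.add M).

Definition reduced (M : nmodType) : Prop :=
  forall x : M, (exists y : M, x + y = 0) -> x = 0.

Definition monoid_le (M : nmodType) (a b : M) : Prop :=
  exists c : M, b = a + c.

Definition setadd (M : nmodType) (X Y : set M) : set M :=
  [set x + y | x in X & y in Y].

Definition submonoid_gen (M : nmodType) (Q : set M) : set M :=
  smallest (fun S : set M => GRing.nmod_closed [pred x in S]) Q.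

Definition Ap (M : nmodType) (Q : set M) : set M :=
  [set: M] `\` setadd Q [set: M].

(* A family (lambda_q)_{q in Q} is the restriction to Q of lambda : M -> nat;
   its values outside Q play no role.  The finiteness hypothesis is what makes
   both sums over Q genuine: \sum_(q \in Q) is 0 on infinite supports. *)
Definition linked (M : nmodType) (Q : set M) : Prop :=
  Q !=set0 /\
  forall x : M, x != 0 ->
    exists c : nat, forall lambda : M -> nat,
      finite_set (Q `&` [set q | lambda q != 0%N]) ->
      monoid_le (\sum_(q \in Q) q *+ lambda q) x ->
      (\big[addn/0%N]_(q \in Q) lambda q <= c)%N.

(* Main.v *)
Require Import Defs.
From mathcomp Require Import all_boot all_algebra.
From mathcomp Require Import boolp classical_sets functions cardinality fsbigop.

(** Strip elements of [Q] off a nonzero [x] one at a time: start from [x = x],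
    and as long as [x = y + q_1 + ... + q_n] with [y] outside [Ap Q], write
    [y = q + z] and continue with [z].  A decomposition of length [n] exhibits
    a [Q]-combination below [x] whose coefficients add up to [n], namely the
    one whose coefficient at [q] is the multiplicity of [q] in the list of
    stripped elements.  The link bound [c(x)] therefore forces the process to
    stop ([peeling_bounded]), and it can only stop with a remainder in [Ap Q]
    ([peeling]).  The link bound says nothing about [x = 0], but there
    [0 = 0 + 0] works: since [M] is reduced, [0] is not of the form [q + z]
    with [q] nonzero. *)

Import GRing.Theory.

Local Open Scope classical_set_scope.
Local Open Scope ring_scope.

(** Stated for an arbitrary commutative law so that it evaluates both the
    weighted sum in [M] and the sum of the weights in [nat]. *)
Lemma fsbig_iterop_count (R : Type) (idx : R) (op : Monoid.com_law idx)
    (T : choiceType) (A : set T) (s : seq T) (F : T -> R) :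
  [set` s] `<=` A ->
  \big[op/idx]_(i \in A) iterop (count_mem i s) op (F i) idx =
  \big[op/idx]_(i <- s) F i.
Proof.
move=> sA; rewrite (fsbigE (undup s)) ?undup_uniq //.
- rewrite big_undup_iterop_count big_seq_cond [RHS]big_seq.
  by apply: eq_bigl => i; case: (boolP (i \in s)) => //= /sA /mem_set ->.
- by move=> i /=; rewrite mem_undup => /sA.
- by move=> i _; rewrite mem_undup => /count_memPn ->.
Qed.

Lemma sum_submonoid_gen (M : nmodType) (Q : set M) (s : seq M) :
  [set` s] `<=` Q -> submonoid_gen Q (\sum_(q <- s) q).
Proof.
move=> sQ S [[S0 SD] QS]; apply/set_mem; rewrite big_seq.
by elim/big_ind: _ => // q /sQ /QS /mem_set.
Qed.

(** Applying the link bound to the multiplicity function of [s] bounds the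
    length of [s]. *)
Lemma peeling_bounded (M : nmodType) (Q : set M) (x : M) :
  linked Q -> x != 0 ->
  exists c : nat, forall s : seq M, [set` s] `<=` Q ->
    monoid_le (\sum_(q <- s) q) x -> (size s <= c)%N.
Proof.
move=> [_ lkQ] /lkQ [c cP]; exists c => s sQ les.
have sizeE : \big[addn/0%N]_(q \in Q) count_mem q s = size s.
  rewrite -sum1_size -(@fsbig_iterop_count _ _ addn _ Q s (fun=> 1%N)) //.
  by apply: eq_fsbigr => q _; rewrite Monoid.iteropE iter_addn_0 mul1n.
rewrite -sizeE; apply: cP.
  apply: sub_finite_set (finite_seq s) => q [_ /=].
  by rewrite -lt0n -has_count has_pred1.
by rewrite (@fsbig_iterop_count _ _ +%R _ Q s id).
Qed.

(** If a remainder in [Ap Q] is never reached, each remainder lets one more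
    element of [Q] be stripped, so every length [n] is attained. *)
Lemma peeling (M : nmodType) (Q : set M) (x : M) (n : nat) :
  setadd (Ap Q) (submonoid_gen Q) x \/
  exists (s : seq M) (y : M),
    [/\ size s = n, [set` s] `<=` Q & x = \sum_(q <- s) q + y].
Proof.
elim: n => [|n [|[s [y [sn sQ ->]]]]]; last 2 first.
- by left.
- have [[q Qq [z _ <-]]|yAp] := pselect (setadd Q [set: M] y); last first.
    left; exists y => //; exists (\sum_(q <- s) q).
      exact: sum_submonoid_gen.
    exact: addrC.
  right; exists (q :: s), z; split; first by rewrite /= sn.
    by move=> r /=; rewrite inE => /predU1P[->|/sQ].
  by rewrite big_cons addrCA addrA.
by right; exists [::], x; split; rewrite ?big_nil ?add0r.
Qed.

Lemma Ap0 (M : nmodType) (Q : set M) :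
  reduced M -> (forall q, Q q -> q != 0) -> Ap Q 0.
Proof.
move=> redM Q0; split=> // -[q Qq [z _ qz0]].
by move/eqP: (Q0 q Qq); apply; apply: redM; exists z.
Qed.

Theorem proposition20 (M : nmodType) (hcanc : cancellative M)
    (hred : reduced M) (Q : set M) (hQ : Q !=set0)
    (hQ0 : forall q : M, Q q -> q != 0) (hlinked : linked Q) :
  [set: M] = setadd (Ap Q) (submonoid_gen Q).
Proof.
apply/esym/seteqP; split=> // x _.
have [->|x0] := eqVneq x 0.
  exists 0; first exact: Ap0 _ _ hred hQ0.
  exists 0; last exact: addr0.
  by rewrite -(big_nil 0 +%R xpredT id); apply: sum_submonoid_gen.
have [c cP] := peeling_bounded _ _ _ hlinked x0.
have [//|[s [y [sc sQ xE]]]] := peeling _ Q x c.+1.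
suff : (size s <= c)%N by rewrite sc ltnn.
by apply: cP => //; exists y.
Qed.
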